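(* Let $p_\sigma:\mathbb R^D\to\mathbb R$ be a smooth probability density and let $z\in\mathbb R^D$ with $p_\sigma(z)>0$. For $r>0$ set $$\mu_z=\frac{\int_{B_D(z,\sqrt2r)}\varphi_r(y-z)\,y\,p_\sigma(y)\,dy}{\int_{B_D(z,\sqrt2r)}\varphi_r(y-z)\,p_\sigma(y)\,dy}.$$ Then, as $r\to0^+$, $$\mu_z=z+r^2\,\frac{2B\,\nabla p_\sigma(z)}{A\,p_\sigma(z)}+O(r^4),$$ where $A=\int_{B_D(0,1)}\varphi_1(\sqrt2u)\,du$ and $B=\int_{B_D(0,1)}(u^{(1)})^2\varphi_1(\sqrt2u)\,du$.
   Context: $B_D(z,\rho)$ is the open Euclidean ball in $\mathbb R^D$ and $u^{(1)}$ is the first coordinate of $u$. $\varphi_1:\mathbb R^D\to[0,\infty)$ is a fixed smooth rotation-invariant function, not identically zero, vanishing outside $B_D(0,\sqrt2)$, and $\varphi_r(z)=r^{-D}\varphi_1(z/r)$ for $r>0$. For example, the truncated Gaussian $\varphi_r(z)=(2\pi r^2)^{-D/2}e^{-\|z\|^2/(2r^2)}\chi(\|z\|/(\sqrt2 r))$, with $\chi:[0,\infty)\to[0,1]$ smooth, $\chi=1$ on $[0,\rho_0]$ for some $\rho_0<1$ and $\chi=0$ on $[1,\infty)$. The quantity $\mu_z$ is $\mathbb E(\varphi_r(Y-z)Y)/\mathbb E(\varphi_r(Y-z))$ for $Y$ with density $p_\sigma$. The $O(r^4)$ is for fixed $p_\sigma$ and $z$. *)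

(* Defs.v *)
From HB Require Import structures.
From mathcomp Require Import all_boot all_order all_algebra.
From mathcomp Require Import all_classical all_reals all_analysis.

Set Implicit Arguments.
Unset Strict Implicit.
Unset Printing Implicit Defensive.

Import Order.TTheory GRing.Theory Num.Theory.
Import numFieldNormedType.Exports.

Local Open Scope classical_set_scope.
Local Open Scope ring_scope.

Definition rV_display : measure_display.
Proof. exact: default_measure_display. Qed.

(* The sigma-algebra on R^n is the product one, generated by the coordinates;
   it coincides with the Borel sigma-algebra. *)
Section measurable_rV.
Variables (R : realType) (n : nat).

Let coord (i : 'I_n) (x : 'rV[R]_n) : measurableTypeR R := x ord0 i.

Let rV_set0 : g_sigma_preimage coord set0.
Proof. exact: sigma_algebra0. Qed.

Let rV_setC A : g_sigma_preimage coord A -> g_sigma_preimage coord (~` A).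
Proof. exact: sigma_algebraC. Qed.

Let rV_bigcup (F : (set _)^nat) : (forall i, g_sigma_preimage coord (F i)) ->
  g_sigma_preimage coord (\bigcup_i (F i)).
Proof. exact: sigma_algebra_bigcup. Qed.

HB.instance Definition _ := @isMeasurable.Build rV_display
  'rV[R]_n (g_sigma_preimage coord) rV_set0 rV_setC rV_bigcup.

End measurable_rV.

Section lebesgue_rV.
Variable R : realType.

Definition cons_rV n (p : measurableTypeR R * 'rV[R]_n) : 'rV[R]_n.+1 :=
  row_mx (p.1 : R)%:M p.2.

Lemma cons_rV0 n p : @cons_rV n p ord0 ord0 = p.1.
Proof. by rewrite /cons_rV mxE; case: splitP => // j _; rewrite (ord1 j) mxE. Qed.

Lemma cons_rVS n p j : @cons_rV n p ord0 (lift ord0 j) = p.2 ord0 j.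
Proof.
rewrite /cons_rV mxE; case: splitP => [k|k /= []]; first by rewrite ord1.
by move=> /val_inj <-.
Qed.

Definition uncons_rV n (x : 'rV[R]_n.+1) : measurableTypeR R * 'rV[R]_n :=
  (x ord0 ord0, \row_j x ord0 (lift ord0 j)).

Lemma cons_rVK n : cancel (@cons_rV n) (@uncons_rV n).
Proof.
move=> p; rewrite /uncons_rV cons_rV0 [RHS]surjective_pairing; congr pair.
by apply/rowP => j; rewrite mxE cons_rVS.
Qed.

Lemma uncons_rVK n : cancel (@uncons_rV n) (@cons_rV n).
Proof.
move=> x; apply/rowP => i; case: (unliftP ord0 i) => [j|] ->.
  by rewrite cons_rVS mxE.
by rewrite cons_rV0.
Qed.

Lemma measurable_coord_rV n (i : 'I_n) :
  measurable_fun setT (fun x : 'rV[R]_n => x ord0 i : measurableTypeR R).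
Proof.
move=> _ Y mY; rewrite setTI; apply: sub_sigma_algebra => /=.
rewrite -bigcup_seq/=; exists i => /=; first by rewrite mem_index_enum.
by exists Y => //; rewrite setTI.
Qed.

Lemma measurable_fun_rV d (T : measurableType d) n (f : T -> 'rV[R]_n) :
  (forall i, measurable_fun setT (fun t => f t ord0 i : measurableTypeR R)) ->
  measurable_fun setT f.
Proof.
move=> mf _ Y mY; rewrite setTI.
have := @g_sigma_preimage_comp _ (measurableTypeR R) n 'rV[R]_n
  (fun i x => x ord0 i) T f.
move=> E.
have : preimage_set_system setT f (g_sigma_preimage
    (fun (i : 'I_n) (x : 'rV[R]_n) => x ord0 i : measurableTypeR R)) (f @^-1` Y).
  by exists Y => //; rewrite setTI.
rewrite -E; apply: smallest_sub; first exact: sigma_algebra_measurable.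
rewrite -bigcup_seq => A [i _] [B mB <-].
exact: mf.
Qed.

Lemma measurable_cons_rV n : measurable_fun setT (@cons_rV n).
Proof.
apply: measurable_fun_rV => i; case: (unliftP ord0 i) => [j|] ->.
  under eq_fun do rewrite cons_rVS.
  apply: (measurableT_comp (measurable_coord_rV j)); exact: measurable_snd.
under eq_fun do rewrite cons_rV0.
exact: measurable_fst.
Qed.

Lemma measurable_uncons_rV n : measurable_fun setT (@uncons_rV n).
Proof.
apply: measurable_fun_pair; first exact: measurable_coord_rV.
apply: measurable_fun_rV => i.
by under eq_fun do rewrite mxE; exact: measurable_coord_rV.
Qed.


Lemma measurable_preimage_uncons n (A : set (measurableTypeR R * 'rV[R]_n)) :
  measurable A -> measurable (@uncons_rV n @^-1` A).
Proof.
by move=> mA; rewrite -[X in measurable X]setTI; exact: measurable_uncons_rV.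
Qed.

Section lebesgue_rV_step.
Variables (n : nat) (mu : {sigma_finite_measure set 'rV[R]_n -> \bar R}).

Definition lebesgue_rV_step : set 'rV[R]_n.+1 -> \bar R :=
  pushforward (@lebesgue_measure R \x mu)%E (@cons_rV n).

Let mcons := @measurable_cons_rV n.

Let step0 : lebesgue_rV_step set0 = 0%E.
Proof. by rewrite /lebesgue_rV_step /pushforward preimage_set0 measure0. Qed.

Let step_ge0 A : (0 <= lebesgue_rV_step A)%E.
Proof. exact: measure_ge0. Qed.

Let step_sigma_additive : semi_sigma_additive lebesgue_rV_step.
Proof.
exact: (@measure_semi_sigma_additive _ _ _
  (pushforward (@lebesgue_measure R \x mu)%E (@cons_rV n))).
Qed.

HB.instance Definition _ := isMeasure.Build _ _ _ lebesgue_rV_step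
  step0 step_ge0 step_sigma_additive.

Let step_sigma_finite : sigma_finite setT lebesgue_rV_step.
Proof.
have /sigma_finiteP[F [TF ndF Foo]] := sigma_finiteT (@lebesgue_measure R).
have /sigma_finiteP[G [TG ndG Goo]] := sigma_finiteT mu.
exists (fun k => @uncons_rV n @^-1` (F k `*` G k)).
  rewrite -preimage_bigcup [X in _ @^-1` X](_ : _ = setT) ?preimage_setT//.
  rewrite -setXTT TF TG predeqE => -[x y]; split.
    by move=> [k _ []/= ? ?]; split; exists k.
  move=> [/= [k _ Fkx] [l _ Gly]]; exists (maxn k l) => //; split.
  - by move: x Fkx; exact/subsetPset/ndF/leq_maxl.
  - by move: y Gly; exact/subsetPset/ndG/leq_maxr.
move=> k; have [mFk Fk] := Foo k; have [mGk Gk] := Goo k.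
split; first exact: measurable_preimage_uncons (measurableX _ _).
rewrite /lebesgue_rV_step /pushforward -comp_preimage.
rewrite (_ : _ \o _ = id); last by apply/funext => x /=; rewrite cons_rVK.
by rewrite preimage_id product_measure1E// lte_mul_pinfty// ge0_fin_numE.
Qed.

HB.instance Definition _ := Measure_isSigmaFinite.Build _ _ _ lebesgue_rV_step
  step_sigma_finite.

End lebesgue_rV_step.

(* R^(n+1) is identified with R x R^n through [cons_rV]; [lebesgue_rV_box]
   below gives the value on boxes, which characterizes the measure. *)
Fixpoint lebesgue_rV n : {sigma_finite_measure set 'rV[R]_n -> \bar R} :=
  match n with
  | 0 => \d_(0 : 'rV[R]_0)
  | m.+1 => lebesgue_rV_step (lebesgue_rV m)
  end.

Lemma measurable_box n (I : 'I_n -> set R) :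
  (forall i, measurable (I i : set (measurableTypeR R))) ->
  measurable [set x : 'rV[R]_n | forall i, I i (x ord0 i)].
Proof.
move=> mI.
rewrite (_ : [set _ | _] =
    \bigcap_(i in [set: 'I_n]) ((fun x : 'rV[R]_n => x ord0 i) @^-1` I i)).
  apply: fin_bigcap_measurable; first exact: finite_finset.
  move=> i _; rewrite -[X in measurable X]setTI.
  exact: measurable_coord_rV.
by apply/seteqP; split => x /= Ix i => [_|]; exact: Ix.
Qed.

Lemma lebesgue_rV_box n (I : 'I_n -> set R) :
  (forall i, measurable (I i : set (measurableTypeR R))) ->
  lebesgue_rV n [set x : 'rV[R]_n | forall i, I i (x ord0 i)] =
  (\prod_(i < n) lebesgue_measure (I i))%E.
Proof.
elim: n I => [|n IH] I mI /=.
  by rewrite big_ord0 diracE mem_set// => -[].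
rewrite big_ord_recl -IH//.
have mS : measurable [set x : 'rV[R]_n | forall i, I (lift ord0 i) (x ord0 i)].
  exact: (measurable_box (fun i => mI (lift ord0 i))).
rewrite -(product_measure1E lebesgue_measure (lebesgue_rV n))//.
rewrite /lebesgue_rV_step /pushforward; congr (_ _).
apply/seteqP; split => [p /= Ip|p /= [I0 IS] i].
  split=> [|i]; first by rewrite -(cons_rV0 p).
  by rewrite -(cons_rVS p).
case: (unliftP ord0 i) => [j|] ->; first by rewrite cons_rVS; exact: IS.
by rewrite cons_rV0.
Qed.

End lebesgue_rV.

Section euclidean_space.
Variables (R : realType) (n : nat).
Implicit Types (f : 'rV[R]_n -> R) (z : 'rV[R]_n) (r : R).

(* The norm carried by ['rV[R]_n] in the library is the sup norm. *)
Definition enorm z : R := Num.sqrt (\sum_i z ord0 i ^+ 2).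

Definition eball z r : set 'rV[R]_n := [set y | enorm (y - z) < r].

Definition gradient f z : 'rV[R]_n := \row_i 'D_(delta_mx ord0 i) f z.

Fixpoint class_C (k : nat) f : Prop :=
  if k is k'.+1 then
    (forall z, differentiable f z) /\
    (forall i, class_C k' (fun z => 'D_(delta_mx ord0 i) f z))
  else continuous f.

Definition smooth f : Prop := forall k, class_C k f.

Definition orthogonal_mx (Q : 'M[R]_n) : Prop := Q *m Q^T = 1%:M.

(* Invariance under all of O(n), reflections included, i.e. the function is
   radial: for n >= 2 this is the same as invariance under SO(n), and for n = 1,
   where SO(1) is trivial, it says that the function is even. *)
Definition rotation_invariant f : Prop :=
  forall Q : 'M[R]_n, orthogonal_mx Q -> forall z, f (z *m Q) = f z.

Definition probability_density f : Prop :=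
  (forall z, 0 <= f z) /\ (\int[lebesgue_rV R n]_z (f z)%:E)%E = 1%E.

Definition rescale (phi1 : 'rV[R]_n -> R) r z : R :=
  r ^- n * phi1 (r^-1 *: z).

Definition vector_integral (A : set 'rV[R]_n) (f : 'rV[R]_n -> 'rV[R]_n) :
    'rV[R]_n :=
  \row_i \int[lebesgue_rV R n]_(y in A) f y ord0 i.

Definition local_mean (phi1 p : 'rV[R]_n -> R) z r : 'rV[R]_n :=
  let B := eball z (Num.sqrt 2 * r) in
  (\int[lebesgue_rV R n]_(y in B) (rescale phi1 r (y - z) * p y))^-1 *:
  vector_integral B (fun y => (rescale phi1 r (y - z) * p y) *: y).

End euclidean_space.

Definition constA (R : realType) n (phi1 : 'rV[R]_n.+1 -> R) : R :=
  \int[lebesgue_rV R n.+1]_(u in eball 0 1) phi1 (Num.sqrt 2 *: u).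

Definition constB (R : realType) n (phi1 : 'rV[R]_n.+1 -> R) : R :=
  \int[lebesgue_rV R n.+1]_(u in eball 0 1)
    ((u ord0 ord0) ^+ 2 * phi1 (Num.sqrt 2 *: u)).

(* Main.v *)
Require Import Defs.
From mathcomp Require Import all_boot all_order all_algebra.
From mathcomp Require Import all_classical all_reals all_analysis.
From mathcomp Require Import fingroup perm.
From mathcomp Require Import measurable_realfun.
From mathcomp Require Import ring lra.

Set Implicit Arguments.
Unset Strict Implicit.
Unset Printing Implicit Defensive.

Import Order.TTheory GRing.Theory Num.Theory.
Import numFieldNormedType.Exports.

Local Open Scope classical_set_scope.
Local Open Scope ring_scope.

(** Write c = sqrt 2 r and phi(u) = phi1(sqrt 2 u), and let J denote integration
    over the unit ball.  The change of variables y = z + c u turns the i-th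
    coordinate of the local mean into z_i + c N1_i / N0, where
    N0 = J(phi(u) p(z + c u)) and N1_i = J(phi(u) u_i p(z + c u))
    ([local_mean_coord]).

    As phi is radial, N0 and N1_i do not change when the integrands are averaged
    with their images under u |-> -u.  This replaces p(z + c u) by half of
    p(z + c u) + p(z - c u) in N0 and by half of p(z + c u) - p(z - c u) in
    N1_i.  These combinations are 2 p(z) + O(|c u|^2) and
    2 c (u . grad p(z)) + O(|c u|^3), the terms of order |c u| and |c u|^2
    having cancelled ([bigO_at0_even_difference], [bigO_at0_odd_difference]).
    Both bounds are obtained by integrating along segments from the origin,
    starting from the local Lipschitz bound that differentiability of the highest
    partial derivatives provides; no Taylor formula in several variables is
    needed.

    Since J(phi) = A and J(phi u_i u_j) = B if i = j and 0 otherwise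
    ([weighted_second_moment], by reflections and transpositions of the
    coordinates), this gives N0 = A p(z) + O(c^2) and
    N1_i = c B d_i p(z) + O(c^3).  As A > 0 ([weighted_integral_gt0]), the
    quotient is c N1_i / N0 = c^2 B d_i p(z) / (A p(z)) + O(c^4)
    ([quotient_expansion]), and c^2 = 2 r^2.

    All changes of variables in R^n that occur (translations, homotheties,
    reflections, permutations of coordinates) map boxes to boxes, so that their
    effect on Lebesgue measure follows from dimension one, boxes being a
    generating pi-system ([lebesgue_monomial_map], [Rintegral_monomial_map]). *)

(** * Borel sets of R^n *)

Section borel_rV.
Variables (R : realType) (n : nat).
Implicit Types (x : 'rV[R]_n) (U : set 'rV[R]_n) (f : 'rV[R]_n -> R).

Lemma coord_le_norm x i : `|x ord0 i| <= `|x|.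
Proof.
rewrite [leRHS]/Num.norm /= mx_normrE.
exact: (le_bigmax _ (fun j : 'I_1 * 'I_n => `|x j.1 j.2|) (ord0, i)).
Qed.

Lemma ball_rV_box x (e : R) : 0 < e ->
  ball x e = [set y | forall i, ball (x ord0 i) e (y ord0 i)].
Proof.
move=> e0; apply/seteqP; split=> y /=; first by move=> [_ H] i; exact: H.
by move=> H; split=> // i j; rewrite ord1; exact: H.
Qed.

Lemma measurable_ball_rV x (e : R) : 0 < e -> measurable (ball x e).
Proof.
move=> e0; rewrite ball_rV_box//.
apply: (@measurable_box R n (fun i => ball (x ord0 i) e)) => i.
exact: measurable_ball.
Qed.

(** An open set is the union of the balls with rational centre and radius of
    the form 1/(m+1) that it contains, and balls for the sup norm are boxes. *)
Lemma open_measurable_rV U : open U -> measurable U.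
Proof.
move=> oU.
pose F (k : 'rV[rat]_n * nat) : set 'rV[R]_n :=
  let b := ball (map_mx (@ratr R) k.1) (k.2.+1%:R^-1 : R) in
  if pselect (b `<=` U) then b else set0.
rewrite (_ : U = \bigcup_k F k); last first.
  apply/seteqP; split=> [x Ux|x [k _]]; last first.
    by rewrite /F; case: pselect => //= + ?; apply.
  have /nbhs_ballP[e /= e0 xeU] : nbhs x U by apply: open_nbhs_nbhs.
  have [m] : exists m : nat, 0 + (m.+1%:R^-1 : R) < e / 2.
    by apply: ltr_add_invr; rewrite divr_gt0.
  rewrite add0r => me.
  have m0 : 0 < (m.+1%:R^-1 : R) by rewrite invr_gt0.
  have /choice[q Hq] : forall i, exists q : rat,
      ratr q \in `](x ord0 i), (x ord0 i + m.+1%:R^-1)[.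
    by move=> i; apply: rat_in_itvoo; rewrite ltrDl.
  have xq i : `|ratr (q i) - x ord0 i| < m.+1%:R^-1.
    have := Hq i; rewrite in_itv/= => /andP[q1 q2].
    by rewrite ger0_norm ?subr_ge0 1?ltW// ltrBlDl.
  exists (\row_i q i, m) => //; rewrite /F; case: pselect => /=.
    by move=> _; rewrite ball_rV_box// => i; rewrite !mxE; exact: xq.
  case=> y; rewrite ball_rV_box// => Hy; apply: xeU.
  rewrite ball_rV_box// => i /=.
  have := Hy i; rewrite !mxE /ball/= => yq.
  rewrite distrC -(subrK (ratr (q i)) (y ord0 i)) -addrA.
  rewrite (le_lt_trans (ler_normD _ _))// (splitr e).
  by rewrite ltrD// (lt_trans _ me)// distrC// distrC.
apply: countable_bigcupT_measurable => [|k]; first exact: countableP.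
rewrite /F.
case: pselect => [sU|nsU] /=; last exact: measurable0.
by apply: measurable_ball_rV; rewrite invr_gt0.
Qed.

Lemma continuous_measurable_rV f : continuous f ->
  measurable_fun setT (f : 'rV[R]_n -> measurableTypeR R).
Proof.
move=> /continuousP cf; apply: (measurability _ (@RGenOpens.measurableE R)).
move=> _ [_ [a [b ->] <-]]; rewrite setTI.
by apply: open_measurable_rV; apply: cf; exact: interval_open.
Qed.

End borel_rV.

(** * Lebesgue measure under monomial affine maps *)

Section affine_change_of_variables.
Variable R : realType.

Lemma lebesgue_measure_affine (a b : R) (A : set (measurableTypeR R)) :
  a != 0 -> measurable A ->
  lebesgue_measure ((fun x : measurableTypeR R => a * x + b) @^-1` A) =
  ((`|a|^-1)%:E * lebesgue_measure A)%E.
Proof.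
move=> a0 mA; pose T (x : measurableTypeR R) : measurableTypeR R := a * x + b.
have mT : measurable_fun setT T.
  by apply: measurable_funD => //; exact: measurable_funM.
suff -> : lebesgue_measure A =
    mscale (NngNum (normr_ge0 a)) (pushforward (@lebesgue_measure R) T) A.
  by rewrite /mscale/= muleA -EFinM mulVf ?normr_eq0// mul1e.
move=> {}mT; apply: lebesgue_measure_unique => // _ [[x y]] _ <-.
rewrite /= /mscale /pushforward/=.
have [alt0|agt0|aeq0] := ltgtP a 0; last by rewrite aeq0 eqxx in a0.
- rewrite [X in (_ * lebesgue_measure X)%E]
    (_ : _ = `[(y - b) / a, (x - b) / a[%classic); last first.
    apply/seteqP; split=> u; rewrite /= !in_itv/= /T.
      by rewrite ler_ndivrMr// ltr_ndivlMr//; lra.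
    by rewrite ler_ndivrMr// ltr_ndivlMr//; lra.
  rewrite !lebesgue_measure_itv/= !lte_fin ltr_nM2r ?invr_lt0// ltrD2r.
  case: ifPn => xy; last by rewrite mule0.
  rewrite -!EFinB -EFinM ltr0_norm//; congr EFin; field; lra.
- rewrite [X in (_ * lebesgue_measure X)%E]
    (_ : _ = `](x - b) / a, (y - b) / a]%classic); last first.
    apply/seteqP; split=> u; rewrite /= !in_itv/= /T.
      by rewrite ler_pdivlMr// ltr_pdivrMr//; lra.
    by rewrite ler_pdivlMr// ltr_pdivrMr//; lra.
  rewrite !lebesgue_measure_itv/= !lte_fin ltr_pM2r ?invr_gt0// ltrD2r.
  case: ifPn => xy; last by rewrite mule0.
  rewrite -!EFinB -EFinM gtr0_norm//; congr EFin; field; lra.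
Qed.

(** The affine map of R^n that sends x to the vector with i-th coordinate
    a_i x_(s i) + b_i.  Translations, homotheties, reflections and permutations
    of the coordinates are of this form, and the inverse image of a box under
    such a map is a box. *)
Definition monomial_map n (a : 'I_n -> R) (s : 'S_n) (b : 'I_n -> R)
    (x : 'rV[R]_n) : 'rV[R]_n :=
  \row_i (a i * x ord0 (s i) + b i).

Variable n : nat.
Implicit Types (a b : 'I_n -> R) (s : 'S_n).

Lemma measurable_monomial_map a s b : measurable_fun setT (monomial_map a s b).
Proof.
apply: measurable_fun_rV => i; under eq_fun do rewrite mxE.
apply: measurable_funD => //; apply: measurable_funM => //.
exact: measurable_coord_rV.
Qed.

(** The product of the sets I_0, ..., I_(n-1). *)
Definition box_rV (I : 'I_n -> set R) : set 'rV[R]_n :=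
  [set x | forall i, I i (x ord0 i)].

Lemma box_rV_sigma_algebra :
  (@measurable _ 'rV[R]_n) = <<s [set box_rV I | I in
    [set I | forall i, measurable (I i : set (measurableTypeR R))]] >>.
Proof.
apply/seteqP; split=> [A|].
  apply: smallest_sub; first exact: smallest_sigma_algebra.
  move=> B; rewrite -bigcup_seq => -[i _ [C mC <-]].
  apply: sub_sigma_algebra => /=.
  exists (fun j => if j == i then C else setT).
    by move=> j /=; case: ifP.
  rewrite setTI; apply/seteqP; split=> x; rewrite /box_rV /=.
    by move=> /(_ i); rewrite eqxx.
  by move=> Cx j; case: eqP => // ->.
apply: smallest_sub; first exact: sigma_algebra_measurable.
by move=> _ [I mI <-]; exact: measurable_box.
Qed.

(** Both sides are measures that agree on boxes, by the one-dimensional case;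
    boxes form a generating pi-system. *)
Lemma lebesgue_monomial_map a s b (A : set 'rV[R]_n) :
  (forall i, a i != 0) -> measurable A ->
  pushforward (lebesgue_rV R n) (monomial_map a s b) A =
  ((`|\prod_i a i|^-1)%:E * lebesgue_rV R n A)%E.
Proof.
move=> a0 mA.
have k0 : 0 <= `|\prod_i a i|^-1 by rewrite invr_ge0.
rewrite -[RHS]/(mscale (NngNum k0) (lebesgue_rV R n) A).
have mT := measurable_monomial_map a s b.
have box_pushforward I : (forall i, measurable (I i : set (measurableTypeR R))) ->
    pushforward (lebesgue_rV R n) (monomial_map a s b) (box_rV I) =
    mscale (NngNum k0) (lebesgue_rV R n) (box_rV I).
  move=> mI; rewrite /pushforward /mscale /= lebesgue_rV_box//.
  pose J j := (fun x : measurableTypeR R =>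
    a ((s^-1)%g j) * x + b ((s^-1)%g j)) @^-1` I ((s^-1)%g j).
  rewrite (_ : _ @^-1` _ = box_rV J); last first.
    apply/seteqP; split=> x /= H i.
      by have := H ((s^-1)%g i); rewrite mxE permKV.
    by have := H (s i); rewrite mxE /J permK.
  have mJ j : measurable (J j : set (measurableTypeR R)).
    rewrite /J -[X in measurable X]setTI.
    suff : measurable_fun setT (fun x : measurableTypeR R =>
      a ((s^-1)%g j) * x + b ((s^-1)%g j) : measurableTypeR R) by apply.
    by apply: measurable_funD => //; exact: measurable_funM.
  rewrite lebesgue_rV_box//.
  rewrite (eq_bigr (fun j => (`|a ((s^-1)%g j)|^-1)%:E *
      lebesgue_measure (I ((s^-1)%g j) : set (measurableTypeR R)))%E); last first.
    by move=> j _; exact: lebesgue_measure_affine.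
  rewrite (reindex_inj (@perm_inj _ s))/=.
  under eq_bigr do rewrite permK.
  rewrite big_split/=; congr (_ * _)%E.
  by rewrite normr_prod -prodfV prodEFin.
apply: (measure_unique [set box_rV I | I in
    [set I | forall i, measurable (I i : set (measurableTypeR R))]]
  (fun k => box_rV (fun=> `[- k%:R, k%:R]%classic))) => //.
- exact: box_rV_sigma_algebra.
- move=> _ _ [I mI <-] [J mJ <-]; exists (fun i => I i `&` J i).
    by move=> i; apply: measurableI.
  apply/seteqP; split=> x /=; first by move=> H; split=> i; have [] := H i.
  by move=> [H K] i; split.
- by move=> k; exists (fun=> `[- k%:R, k%:R]%classic) => //= i; exact: measurable_itv.
- apply/seteqP; split=> // x _; exists (Num.truncn `|x|).+1 => // i /=.
  rewrite in_itv/= -ler_norml (le_trans (coord_le_norm x i))//.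
  by rewrite ltW// truncnS_gt.
- by move=> _ [I mI <-]; exact: box_pushforward.
- move=> k; pose K (_ : 'I_n) : set R := `[- k%:R, k%:R]%classic.
  suff : (pushforward (lebesgue_rV R n) (monomial_map a s b) (box_rV K)
    < +oo)%E by [].
  rewrite box_pushforward; last by move=> i; exact: measurable_itv.
  rewrite /mscale/= lebesgue_rV_box; last by move=> i; exact: measurable_itv.
  rewrite (eq_bigr (fun=> (k%:R + k%:R)%:E)); last first.
    move=> i _; rewrite /K lebesgue_measure_itv/= lte_fin -EFinB opprK.
    by case: ltP => // kk; congr EFin; have := ler0n R k; lra.
  by rewrite prodEFin -EFinM ltry.
Qed.

End affine_change_of_variables.

(** * Integration over Euclidean balls *)

Section euclidean_ball.
Variables (R : realType) (n : nat).
Implicit Types (x z : 'rV[R]_n) (f : 'rV[R]_n -> R) (r : R).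

Lemma coord_le_enorm x i : `|x ord0 i| <= enorm x.
Proof.
rewrite -sqrtr_sqr /enorm ler_wsqrtr// (bigD1 i)//= lerDl.
by apply: sumr_ge0 => j _; exact: sqr_ge0.
Qed.

Lemma enorm_ge0 x : 0 <= enorm x.
Proof. exact: sqrtr_ge0. Qed.

Lemma norm_le_enorm x : `|x| <= enorm x.
Proof.
rewrite [leLHS]/Num.norm /= mx_normrE; apply/bigmax_leP; split.
  exact: enorm_ge0.
by move=> [i j] _ /=; rewrite ord1; exact: coord_le_enorm.
Qed.

Lemma enormZ r x : enorm (r *: x) = `|r| * enorm x.
Proof.
rewrite /enorm -sqrtr_sqr -sqrtrM ?sqr_ge0// mulr_sumr.
by congr Num.sqrt; apply: eq_bigr => i _; rewrite mxE exprMn.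
Qed.

Lemma enorm_continuous : continuous (@enorm R n).
Proof.
have cq : continuous (fun x : 'rV[R]_n => \sum_i x ord0 i ^+ 2).
  apply: continuous_big => [|i _]; first exact: add_continuous.
  move=> x; apply: (@continuous_comp _ _ _ (fun x : 'rV[R]_n => x ord0 i)
      (fun t : R => t ^+ 2)); [exact: coord_continuous|exact: exprn_continuous].
move=> x; apply: (@continuous_comp _ _ _ _ Num.sqrt); first exact: cq.
exact: sqrt_continuous.
Qed.

Lemma open_eball z r : open (eball z r).
Proof.
have /continuousP H : continuous (fun y : 'rV[R]_n => enorm (y - z)).
  move=> y; apply: (@continuous_comp _ _ _ (fun y : 'rV[R]_n => y - z) (@enorm R n)).
    by apply: continuousB; [exact: cvg_id|exact: cst_continuous].
  exact: enorm_continuous.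
exact: (H _ (@open_lt R r)).
Qed.

Lemma measurable_eball z r : measurable (eball z r).
Proof. by apply: open_measurable_rV; exact: open_eball. Qed.

Lemma eball_sub_box z r :
  eball z r `<=` box_rV (fun i => `[z ord0 i - r, z ord0 i + r]%classic).
Proof.
move=> y; rewrite /eball/= => yr i /=; rewrite in_itv/= -ler_distl.
have := coord_le_enorm (y - z) i; rewrite !mxE => /le_trans; apply.
exact: ltW.
Qed.

Lemma lebesgue_eball_lty z r : (lebesgue_rV R n (eball z r) < +oo)%E.
Proof.
have mI i : measurable (`[z ord0 i - r, z ord0 i + r]%classic :
    set (measurableTypeR R)) by exact: measurable_itv.
apply: (@le_lt_trans _ _ (lebesgue_rV R n
    (box_rV (fun i => `[z ord0 i - r, z ord0 i + r]%classic)))).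
  apply: le_measure; last exact: eball_sub_box.
    by apply/mem_set; exact: measurable_eball.
  by apply/mem_set; exact: measurable_box.
rewrite lebesgue_rV_box//.
rewrite (eq_bigr (fun=> (Num.max 0 (r + r))%:E)) ?prodEFin ?ltry// => i _.
rewrite lebesgue_measure_itv/= lte_fin -EFinB.
by rewrite maxEle; case: ifP; case: ifP => h1 h2; congr EFin; lra.
Qed.

Lemma continuous_integrable_eball f z r : continuous f ->
  (lebesgue_rV R n).-integrable (eball z r) (EFin \o f).
Proof.
move=> cf; apply: measurable_bounded_integrable.
- exact: measurable_eball.
- exact: lebesgue_eball_lty.
- by apply: measurable_funTS; exact: continuous_measurable_rV.
have : compact (f @` box_rV (fun i => `[z ord0 i - r, z ord0 i + r]%classic)).
  apply: continuous_compact; first exact: continuous_subspaceT.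
  by apply: rV_compact => i; exact: segment_compact.
move=> /compact_bounded[M [Mreal HM]]; exists M; split => // N MN y zy.
by apply: HM => //=; exists y => //; exact: eball_sub_box zy.
Qed.

End euclidean_ball.

Lemma Rintegral_monomial_map (R : realType) n (a : 'I_n -> R) (s : 'S_n) b
    (D : set 'rV[R]_n) (f : 'rV[R]_n -> R) :
  (forall i, a i != 0) -> measurable D ->
  (lebesgue_rV R n).-integrable D (EFin \o f) ->
  \int[lebesgue_rV R n]_(y in D) f y =
  `|\prod_i a i| *
    \int[lebesgue_rV R n]_(x in monomial_map a s b @^-1` D)
      f (monomial_map a s b x).
Proof.
move=> a0 mD intf; set mu := lebesgue_rV R n; set T := monomial_map a s b.
have mT : measurable_fun setT T by exact: measurable_monomial_map.
have k0 : 0 <= `|\prod_i a i|^-1 by rewrite invr_ge0.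
have key (g : 'rV[R]_n -> \bar R) : measurable_fun D g ->
    (forall y, 0 <= g y)%E ->
    (\int[mu]_(x in T @^-1` D) (g \o T) x =
     (`|\prod_i a i|^-1)%:E * \int[mu]_(y in D) g y)%E.
  move=> mg g0.
  rewrite -ge0_integral_pushforward//.
  rewrite -(ge0_integral_mscale mu mD (NngNum k0))//.
  apply: eq_measure_integral => A mA _; exact: lebesgue_monomial_map.
have mf : measurable_fun D (EFin \o f) by case/integrableP : intf.
rewrite /Rintegral.
have -> : (\int[mu]_(x in T @^-1` D) (f (T x))%:E =
    (`|\prod_i a i|^-1)%:E * \int[mu]_(y in D) (EFin \o f)^\+ y -
    (`|\prod_i a i|^-1)%:E * \int[mu]_(y in D) (EFin \o f)^\- y)%E.
  rewrite -!key//; [by rewrite -funepos_comp -funeneg_comp -integralE| |].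
    exact: measurable_funeneg.
  exact: measurable_funepos.
have fp : (\int[mu]_(y in D) (EFin \o f)^\+ y \is a fin_num)%E.
  by apply: integrable_fin_num => //; exact: integrable_funepos.
have fn : (\int[mu]_(y in D) (EFin \o f)^\- y \is a fin_num)%E.
  by apply: integrable_fin_num => //; exact: integrable_funeneg.
rewrite -muleBr//; last exact: fin_num_adde_defr.
rewrite -integralE fineM//; last exact: integrable_fin_num.
rewrite /= mulrA mulfV ?mul1r// normr_eq0.
by apply/prodf_neq0 => i _; exact: a0.
Qed.

(** * Symmetric differences of a smooth function *)

Section second_differences.
Variables (R : realType) (n : nat).
Implicit Types (f q : 'rV[R]_n -> R) (z h : 'rV[R]_n).

Lemma derive_rV_sum f z h : differentiable f z ->
  'D_h f z = \sum_i h ord0 i * 'D_(delta_mx ord0 i) f z.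
Proof.
move=> df; rewrite deriveE// {1}(row_sum_delta h) linear_sum.
by apply: eq_bigr => i _; rewrite linearZ/= deriveE.
Qed.

Lemma is_derive_line f z h (t : R) : differentiable f (z + t *: h) ->
  is_derive t 1 (fun s : R => f (z + s *: h))
    (\sum_i h ord0 i * 'D_(delta_mx ord0 i) f (z + t *: h)).
Proof.
move=> df.
(* Both derivatives are limits of the same difference quotient. *)
have E : (fun s : R => s^-1 *: (((fun s => f (z + s *: h)) \o shift t) (s *: 1)
      - f (z + t *: h))) =
    (fun s : R => s^-1 *: ((f \o shift (z + t *: h)) (s *: h) - f (z + t *: h))).
  apply/funext => s /=; congr (_ *: (f _ - _)).
  by rewrite scalerDl addrCA [_ *: 1]mulr1.
have dh : derivable f (z + t *: h) h by exact: diff_derivable.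
apply: DeriveDef; first by rewrite /derivable E.
by rewrite -derive_rV_sum// /derive E.
Qed.

Lemma norm_sub_le_of_is_derive (g dg : R -> R) (C : R) :
  (forall t : R, is_derive t (1 : R) g (dg t)) ->
  (forall t, 0 <= t <= 1 -> `|dg t| <= C) -> `|g 1 - g 0| <= C.
Proof.
move=> gd gC.
have [|c c01 ->] := @MVT_segment R g dg 0 1 ler01 (fun t _ => gd t).
  by apply: derivable_within_continuous => t _; exact: ex_derive.
by rewrite subr0 mulr1; apply: gC; rewrite in_itv/= in c01.
Qed.

Lemma differentiable_lipschitz_at f z : differentiable f z ->
  exists2 C, 0 <= C & \forall h \near (0 : 'rV[R]_n), `|f (z + h) - f z| <= C * `|h|.
Proof.
move=> df.
have /eqO_exP[C C0 HC] : ('d f z : 'rV[R]_n -> R) =O_ (0 : 'rV[R]_n) id.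
  exact: diff_eqO.
have [_ /eqaddoP/(_ _ ltr01) H1] := (diff_locallyP z f).1 df.
exists (1 + C); first by rewrite addr_ge0// ltW.
near=> h.
have : `|f (h + z) - (f z + 'd f z h)| <= 1 * `|h| by near: h; exact: H1.
have : `|'d f z h| <= C * `|h| by near: h; exact: HC.
rewrite (addrC z) mulrDl => dC fd.
rewrite (_ : f (h + z) - f z = (f (h + z) - (f z + 'd f z h)) + 'd f z h).
  by rewrite (le_trans (ler_normD _ _))// lerD.
by rewrite opprD addrA subrK.
Unshelve. all: by end_near. Qed.

Lemma norm_linear_comb_le h (u : 'I_n -> R) (C : R) :
  (forall i, `|u i| <= C) -> `|\sum_i h ord0 i * u i| <= n%:R * C * `|h|.
Proof.
move=> uC; apply: (le_trans (ler_norm_sum _ _ _)).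
rewrite -mulrA -[n in n%:R]card_ord mulr_natl -sumr_const.
apply: ler_sum => i _; rewrite normrM mulrC ler_pM//.
exact: coord_le_norm.
Qed.

(** [bigO_at0 F k] says that F(h) = O(|h|^k) as h tends to 0. *)
Definition bigO_at0 (F : 'rV[R]_n -> R) (k : nat) : Prop :=
  exists2 C, 0 <= C & \forall h \near (0 : 'rV[R]_n), `|F h| <= C * `|h| ^+ k.

Lemma bigO_at0_uniform (w : 'I_n -> 'rV[R]_n -> R) k :
  (forall i, bigO_at0 (w i) k) ->
  exists2 C, 0 <= C &
    \forall h \near (0 : 'rV[R]_n), forall i, `|w i h| <= C * `|h| ^+ k.
Proof.
move=> wO; have /choice[C /all_and2[C0 HC]] : forall i, exists C, 0 <= C /\
    \forall h \near (0 : 'rV[R]_n), `|w i h| <= C * `|h| ^+ k.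
  by move=> i; have [C C0 HC] := wO i; exists C.
exists (\sum_i C i).
  by apply: sumr_ge0 => i _; exact: C0.
have /filter_forall : forall i,
    \forall h \near (0 : 'rV[R]_n), `|w i h| <= C i * `|h| ^+ k by exact: HC.
apply: filterS => h Hh i; apply: (le_trans (Hh i)).
rewrite ler_wpM2r ?exprn_ge0// (bigD1 i)//= lerDl.
by apply: sumr_ge0 => j _; exact: C0.
Qed.

Lemma near0_segment (P : set 'rV[R]_n) : (\forall h \near (0 : 'rV[R]_n), P h) ->
  \forall h \near (0 : 'rV[R]_n), forall t : R, `|t| <= 1 -> P (t *: h).
Proof.
move=> /nbhs_normP[e /= e0 eP]; apply/nbhs_normP; exists e => //= h /=.
rewrite !sub0r !normrN => he t t1; apply: eP => /=.
rewrite sub0r normrN normrZ.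
by rewrite (le_lt_trans _ he)// ler_piMl.
Qed.

(** Integration along segments from the origin: if the radial derivative of F
    is the combination of the w_i with coefficients h_i, and w_i = O(|h|^k) for
    all i, then F = O(|h|^(k+1)). *)
Lemma bigO_at0_segment (F : 'rV[R]_n -> R) (w : 'I_n -> 'rV[R]_n -> R) k :
  F 0 = 0 ->
  (forall h t, is_derive t (1 : R) (fun s : R => F (s *: h))
     (\sum_i h ord0 i * w i (t *: h))) ->
  (forall i, bigO_at0 (w i) k) -> bigO_at0 F k.+1.
Proof.
move=> F0 dF /bigO_at0_uniform[C C0 HC].
exists (n%:R * C); first by rewrite mulr_ge0.
have := near0_segment HC; apply: filterS => h Hh.
rewrite exprSr mulrA -[n%:R * C * _]mulrA.
have := @norm_sub_le_of_is_derive (fun s => F (s *: h)) _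
  (n%:R * (C * `|h| ^+ k) * `|h|) (dF h).
rewrite scale1r scale0r F0 subr0; apply => t /andP[t0 t1].
apply: norm_linear_comb_le => i.
have {}t1 : `|t| <= 1 by rewrite ger0_norm.
apply: (le_trans (Hh t t1 i)).
by rewrite ler_wpM2l// normrZ exprMn ler_piMl ?exprn_ge0// exprn_ile1.
Qed.

Lemma bigO_at0_oddD f z : differentiable f z ->
  bigO_at0 (fun h => f (z + h) - f (z - h)) 1.
Proof.
move=> /differentiable_lipschitz_at[C C0 HC].
exists (C + C); first by rewrite addr_ge0.
have := near0_segment HC; apply: filterS => h Hh.
have h1 : `|f (z + h) - f z| <= C * `|h|.
  by have := Hh 1; rewrite normr1 scale1r; apply.
have h2 : `|f (z - h) - f z| <= C * `|h|.
  by have := Hh (-1); rewrite normrN normr1 scaleN1r normrN; apply.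
rewrite expr1 mulrDl (_ : _ - _ = (f (z + h) - f z) - (f (z - h) - f z)).
  by rewrite (le_trans (ler_normB _ _))// lerD.
by rewrite opprB addrA subrK.
Qed.

Lemma is_derive_line_opp f z h (t : R) : differentiable f (z - t *: h) ->
  is_derive t (1 : R) (fun s : R => f (z - s *: h))
    (- \sum_i h ord0 i * 'D_(delta_mx ord0 i) f (z - t *: h)).
Proof.
rewrite -scalerN => df.
under eq_fun do rewrite -scalerN.
apply: is_derive_eq; first exact: is_derive_line.
by rewrite -sumrN; apply: eq_bigr => i _; rewrite mxE mulNr.
Qed.

(** The second-order bound for q reduces to the first-order bound for the odd
    differences of its partial derivatives. *)
Lemma bigO_at0_even_difference q z :
  (forall x, differentiable q x) ->
  (forall i, differentiable (fun x => 'D_(delta_mx ord0 i) q x) z) ->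
  bigO_at0 (fun h => q (z + h) + q (z - h) - 2 * q z) 2.
Proof.
move=> dq ddq; pose w i h := 'D_(delta_mx ord0 i) q (z + h)
  - 'D_(delta_mx ord0 i) q (z - h).
apply: (@bigO_at0_segment _ w) => [|h t|i].
- by rewrite subr0 addr0 mulr_natl subrr.
- have D1 := is_derive_line (dq (z + t *: h)).
  have D2 := is_derive_line_opp (dq (z - t *: h)).
  apply: is_derive_eq.
  rewrite subr0 -sumrB; apply: eq_bigr => i _; by rewrite -mulrBr.
- exact: (@bigO_at0_oddD (fun x => 'D_(delta_mx ord0 i) q x)).
Qed.

(** The third-order bound for p reduces to the second-order bound for the even
    differences of its partial derivatives. *)
Lemma bigO_at0_odd_difference p z :
  (forall x, differentiable p x) ->
  (forall i x, differentiable (fun x => 'D_(delta_mx ord0 i) p x) x) ->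
  (forall i j, differentiable (fun x => 'D_(delta_mx ord0 j)
     (fun y => 'D_(delta_mx ord0 i) p y) x) z) ->
  bigO_at0 (fun h => p (z + h) - p (z - h)
    - 2 * \sum_i h ord0 i * 'D_(delta_mx ord0 i) p z) 3.
Proof.
move=> dp ddp dddp; pose w i h := 'D_(delta_mx ord0 i) p (z + h)
  + 'D_(delta_mx ord0 i) p (z - h) - 2 * 'D_(delta_mx ord0 i) p z.
apply: (@bigO_at0_segment _ w) => [|h t|i].
- rewrite subr0 addr0 subrr sub0r big1 ?mulr0 ?oppr0// => i _.
  by rewrite mxE mul0r.
- have D1 := is_derive_line (dp (z + t *: h)).
  have D2 := is_derive_line_opp (dp (z - t *: h)).
  pose L := \sum_i h ord0 i * 'D_(delta_mx ord0 i) p z.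
  rewrite (_ : (fun s : R => _) = (fun s : R => p (z + s *: h) - p (z - s *: h)
    - (2 * L) * s)); last first.
    apply/funext => s; congr (_ - _); rewrite -mulrA; congr (2 * _).
    rewrite mulr_suml; apply: eq_bigr => i _; rewrite mxE; ring.
  apply: is_derive_eq.
  rewrite opprK [(2 * L)%:A]mulr1 /L -big_split/= mulr_sumr -sumrB.
  by apply: eq_bigr => i _; rewrite /w; ring.
- exact: (bigO_at0_even_difference (ddp i) (dddp i)).
Qed.

End second_differences.

(** * Invariance under signed permutations *)

Section signed_permutations.
Variables (R : realType) (n : nat).
Implicit Types (a : 'I_n -> R) (s : 'S_n) (f phi : 'rV[R]_n -> R).

Local Notation mu := (lebesgue_rV R n).
Local Notation signed_perm a s := (monomial_map a s (fun=> 0)).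

Lemma monomial_map_homothety (z u : 'rV[R]_n) (c : R) :
  monomial_map (fun=> c) 1%g (fun i => z ord0 i) u = z + c *: u.
Proof. by apply/rowP => i; rewrite !mxE perm1 addrC. Qed.

(** Change of variables y = z + c u, from the unit ball to the ball of centre z
    and radius c. *)
Lemma Rintegral_eball f (z : 'rV[R]_n) (c : R) : 0 < c -> continuous f ->
  \int[mu]_(y in eball z c) f y =
  c ^+ n * \int[mu]_(u in eball 0 1) f (z + c *: u).
Proof.
move=> c0 cf.
rewrite (@Rintegral_monomial_map R n (fun=> c) 1%g (fun i => z ord0 i))//;
  [|by rewrite gt_eqF|exact: measurable_eball|exact: continuous_integrable_eball].
rewrite prodr_const card_ord ger0_norm ?exprn_ge0 1?ltW//; congr (_ * _).
under eq_Rintegral do rewrite monomial_map_homothety.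
rewrite (_ : _ @^-1` _ = eball 0 1)//; apply/seteqP.
by split=> u; rewrite /eball/= monomial_map_homothety subr0 addrC addKr enormZ
  gtr0_norm// gtr_pMr.
Qed.

(** A signed permutation is right multiplication by an orthogonal matrix. *)
Lemma rotation_invariant_signed_perm f a s u : rotation_invariant f ->
  (forall i, a i ^+ 2 = 1) -> f (signed_perm a s u) = f u.
Proof.
move=> rf a1; pose Q : 'M[R]_n := \matrix_(j, i) (a i *+ (j == s i)).
rewrite (_ : signed_perm a s u = u *m Q); last first.
  apply/rowP => i; rewrite !mxE addr0 (bigD1 (s i))//= !mxE eqxx mulr1n.
  rewrite mulrC big1 ?addr0// => j /negPf jsi.
  by rewrite mxE jsi mulr0n mulr0.
apply: rf; apply: mulmx1C; apply/matrixP => i k; rewrite !mxE.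
rewrite (bigD1 (s i))//= !mxE eqxx mulr1n big1 ?addr0 => [|j /negPf jsi].
  by rewrite (inj_eq perm_inj); case: eqP => [<-|]; rewrite ?mulr1n 
    ?mulr0n ?mulr0// -expr2.
by rewrite !mxE jsi mulr0n mul0r.
Qed.

Lemma enorm_signed_perm a s u : (forall i, a i ^+ 2 = 1) ->
  enorm (signed_perm a s u) = enorm u.
Proof.
move=> a1; congr Num.sqrt; rewrite [RHS](reindex_inj (@perm_inj _ s)).
by apply: eq_bigr => i _; rewrite mxE addr0 exprMn a1 mul1r.
Qed.

Lemma Rintegral_signed_perm f a s r : (forall i, a i ^+ 2 = 1) ->
  continuous f ->
  \int[mu]_(u in eball 0 r) f u =
  \int[mu]_(u in eball 0 r) f (signed_perm a s u).
Proof.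
move=> a1 cf.
rewrite (@Rintegral_monomial_map R n a s (fun=> 0))//;
  [|by move=> i; rewrite -sqrf_eq0 a1 oner_eq0|exact: measurable_eball
   |exact: continuous_integrable_eball].
rewrite (_ : _ @^-1` _ = eball 0 r); last first.
  by apply/seteqP; split=> u; rewrite /eball/= !subr0 enorm_signed_perm.
rewrite (_ : `|_| = 1) ?mul1r//.
apply/eqP; rewrite -(@pexpr_eq1 _ _ 2)// normr_prod -prodrXl; apply/eqP.
by rewrite big1// => i _; rewrite real_normK ?num_real.
Qed.

End signed_permutations.

(** * Moments of a radial weight *)

Section weighted_moments.
Variables (R : realType) (n : nat).
Implicit Types (f g phi : 'rV[R]_n -> R).

Local Notation mu := (lebesgue_rV R n).
Local Notation J f := (\int[mu]_(u in eball 0 1) f u).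

Lemma Rintegral_unit_ballD f g : continuous f -> continuous g ->
  J (fun u => f u + g u) = J f + J g.
Proof.
move=> cf cg; apply: RintegralD; [exact: measurable_eball| |];
  exact: continuous_integrable_eball.
Qed.

Lemma Rintegral_unit_ballZ (c : R) f : continuous f -> J (fun u => c * f u) = c * J f.
Proof.
move=> cf; apply: RintegralZl; first exact: measurable_eball.
exact: continuous_integrable_eball.
Qed.

Lemma continuousM_fun f g : continuous f -> continuous g ->
  continuous (fun u => f u * g u).
Proof. by move=> cf cg u; apply: continuousM; [exact: cf|exact: cg]. Qed.

Lemma continuousD_fun f g : continuous f -> continuous g ->
  continuous (fun u => f u + g u).
Proof. by move=> cf cg u; apply: continuousD; [exact: cf|exact: cg]. Qed.

Lemma continuous_affine f (z : 'rV[R]_n) (c : R) : continuous f ->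
  continuous (fun u : 'rV[R]_n => f (z + c *: u)).
Proof.
move=> cf u; apply: (@continuous_comp _ _ _ (fun u : 'rV[R]_n => z + c *: u) f).
  apply: continuousD; first exact: cst_continuous.
  exact: scaler_continuous.
exact: cf.
Qed.

(** If |g| <= M on the unit ball, then the phi-weighted integral of g is at
    most M times the total weight. *)
Lemma weighted_integral_le phi g (M : R) : continuous phi -> continuous g ->
  (forall u, 0 <= phi u) -> (forall u, eball 0 1 u -> `|g u| <= M) ->
  `|J (fun u => phi u * g u)| <= M * J phi.
Proof.
move=> cp cg p0 gM; have cpg := continuousM_fun cp cg.
have mB := @measurable_eball R n 0 1.
apply: le_trans.
  by apply: le_normr_Rintegral => //; exact: continuous_integrable_eball.
rewrite -Rintegral_unit_ballZ//; apply: le_Rintegral => //.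
- by apply: integrable_norm; exact: continuous_integrable_eball.
- apply: continuous_integrable_eball; apply: continuousM_fun => //.
  by move=> ?; exact: cst_continuous.
- by move=> u Bu; rewrite normrM ger0_norm// mulrC ler_wpM2r// gM.
Qed.

(** The weight is bounded below by a positive constant on a box around a point
    where it is positive. *)
Lemma weighted_integral_gt0 phi : continuous phi -> (forall u, 0 <= phi u) ->
  (exists2 u, eball 0 1 u & 0 < phi u) -> 0 < J phi.
Proof.
move=> cp p0 [v Bv pv].
have near_ball : nbhs v (eball 0 1).
  by apply: open_nbhs_nbhs; split; first exact: open_eball.
have near_gt : nbhs v [set u | phi v / 2 < phi u].
  apply: (cp v [set y | phi v / 2 < y]); apply: open_nbhs_nbhs.
  by split; [exact: open_gt|rewrite /= ltr_pdivrMr// mulr_natr mulr2n ltrDl].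
have /nbhs_ballP[e /= e0 eB] : nbhs v (eball 0 1 `&` [set u | phi v / 2 < phi u]).
  exact: filterI.
pose I (i : 'I_n) : set R := `]v ord0 i - e, v ord0 i + e[%classic.
have mI i : measurable (I i : set (measurableTypeR R)) by exact: measurable_itv.
have IB : box_rV I `<=` ball v e.
  move=> u Iu; rewrite ball_rV_box// => i; have := Iu i.
  by rewrite /I/= in_itv/= /ball/= -ltr_distl distrC.
have muI : mu (box_rV I) = ((e + e) ^+ n)%:E.
  rewrite lebesgue_rV_box// (eq_bigr (fun=> (e + e)%:E)) => [|i _].
    by rewrite prodEFin prodr_const card_ord.
  rewrite /I lebesgue_measure_itv/= lte_fin ifT; last by lra.
  by rewrite -EFinB; congr EFin; lra.
have mbox : measurable (box_rV I) by exact: measurable_box.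
have mphi (D : set 'rV[R]_n) : measurable_fun D (EFin \o phi).
  apply/measurable_EFinP; apply: measurable_funTS.
  exact: continuous_measurable_rV.
have : (0 < \int[mu]_(u in eball 0 1) (phi u)%:E)%E.
  apply: (@lt_le_trans _ _ (\int[mu]_(u in box_rV I) (phi v / 2)%:E)%E).
    rewrite integral_cst// [X in (_ * X)%E]muI -EFinM lte_fin mulr_gt0 ?divr_gt0//.
    by rewrite exprn_gt0// addr_gt0.
  apply: (@le_trans _ _ (\int[mu]_(u in box_rV I) (phi u)%:E)%E).
    apply: ge0_le_integral => //.
    - by move=> u _; rewrite lee_fin; apply: divr_ge0; [exact: p0|].
    - by move=> u /IB/eB[_ /ltW]; rewrite lee_fin.
  apply: ge0_subset_integral => //.
  - exact: measurable_eball.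
  - by move=> u _; rewrite lee_fin.
  - by move=> u /IB/eB[].
move=> J0; rewrite -lte_fin fineK//.
apply: integrable_fin_num; first exact: measurable_eball.
exact: continuous_integrable_eball.
Qed.

Variable phi : 'rV[R]_n -> R.
Hypotheses (phi_cont : continuous phi) (phi_rot : rotation_invariant phi).

Let coord_cont i : continuous (fun u : 'rV[R]_n => u ord0 i).
Proof. by move=> u; exact: coord_continuous. Qed.

Lemma weighted_integral_opp g : continuous g ->
  J (fun u : 'rV[R]_n => phi u * g u) = J (fun u : 'rV[R]_n => phi u * g (- u)).
Proof.
move=> cg.
rewrite (@Rintegral_signed_perm R n _ (fun=> -1) 1%g)//; last 2 first.
- by move=> i; rewrite sqrrN expr1n.
- exact: continuousM_fun.
apply: eq_Rintegral => u _; rewrite rotation_invariant_signed_perm//; last first.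
  by move=> i; rewrite sqrrN expr1n.
by congr (_ * g _); apply/rowP => i; rewrite !mxE perm1 addr0 mulN1r.
Qed.

(** Off the diagonal, the reflection of the i-th coordinate changes the sign of
    the integrand; on the diagonal, the transposition of the coordinates i and
    k preserves phi and exchanges u_i with u_k. *)
Lemma weighted_second_moment (k i j : 'I_n) :
  J (fun u : 'rV[R]_n => phi u * (u ord0 i * u ord0 j)) =
  J (fun u : 'rV[R]_n => u ord0 k ^+ 2 * phi u) *+ (i == j).
Proof.
have cij (i' j' : 'I_n) :
    continuous (fun u : 'rV[R]_n => phi u * (u ord0 i' * u ord0 j')).
  by apply: continuousM_fun => //; apply: continuousM_fun.
have [<-|ij] := eqVneq i j; last first.
  pose a (l : 'I_n) : R := if l == i then -1 else 1.
  have a1 l : a l ^+ 2 = 1 by rewrite /a; case: ifP; rewrite ?sqrrN expr1n.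
  have : J (fun u : 'rV[R]_n => phi u * (u ord0 i * u ord0 j)) =
      -1 * J (fun u : 'rV[R]_n => phi u * (u ord0 i * u ord0 j)).
    rewrite -Rintegral_unit_ballZ// [LHS](Rintegral_signed_perm 1%g _ a1)//.
    apply: eq_Rintegral => u _; rewrite rotation_invariant_signed_perm//.
    by rewrite !mxE !perm1 /a eqxx eq_sym (negPf ij) !addr0; ring.
  by rewrite mulr0n; lra.
rewrite mulr1n (@Rintegral_signed_perm R n _ (fun=> 1) (tperm i k))//; last first.
  by move=> l; rewrite expr1n.
apply: eq_Rintegral => u _; rewrite rotation_invariant_signed_perm//; last first.
  by move=> l; rewrite expr1n.
by rewrite !mxE tpermL !addr0 !mul1r mulrC.
Qed.

End weighted_moments.

(** * Expansions of the weighted integrals as the scale tends to 0 *)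

Section small_scale_expansions.
Variables (R : realType) (n : nat).

Local Notation mu := (lebesgue_rV R n).
Local Notation J f := (\int[mu]_(u in eball 0 1) f u).

Lemma Rintegral_unit_ball_sum (I : Type) (r : seq I) (f : I -> 'rV[R]_n -> R) :
  (forall i, continuous (f i)) ->
  J (fun u : 'rV[R]_n => \sum_(i <- r) f i u) = \sum_(i <- r) J (f i).
Proof.
move=> cf; elim: r => [|i r IH].
  under eq_Rintegral do rewrite big_nil.
  by rewrite big_nil Rintegral_cst ?mul0r//; exact: measurable_eball.
under eq_Rintegral do rewrite big_cons.
rewrite big_cons Rintegral_unit_ballD ?IH//.
by apply: continuous_big => //; exact: add_continuous.
Qed.

(** The sup norm is at most the Euclidean norm, so that |c u| <= c for u in the
    unit ball. *)
Lemma bigO_at0_unit_ball (F : 'rV[R]_n -> R) k : bigO_at0 F k ->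
  exists2 C, 0 <= C & \forall c \near 0^'+, forall u, eball 0 1 u ->
    `|F (c *: u)| <= C * c ^+ k.
Proof.
move=> [C C0 /nbhs_normP[e /= e0 eF]]; exists C => //.
near=> c.
have c0 : 0 < c by [].
have ce : c < e by near: c; exact: nbhs_right_lt.
move=> u; rewrite /eball/= subr0 => u1.
have uc : `|c *: u| <= c.
  by rewrite normrZ gtr0_norm// ger_pMr// (le_trans (norm_le_enorm u))// ltW.
apply: (@le_trans _ _ (C * `|c *: u| ^+ k)); last first.
  by rewrite ler_wpM2l// lerXn2r// nnegrE// ltW.
by apply: eF => /=; rewrite sub0r normrN (le_lt_trans uc).
Unshelve. all: by end_near. Qed.

Variables (phi p : 'rV[R]_n -> R) (z : 'rV[R]_n).
Hypotheses (phi_cont : continuous phi) (phi_rot : rotation_invariant phi).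
Hypothesis phi_ge0 : forall u, 0 <= phi u.
Hypothesis p_diff : forall x, differentiable p x.

Let p_cont : continuous p.
Proof. by move=> x; exact: differentiable_continuous. Qed.

Let cpN (c : R) : continuous (fun u : 'rV[R]_n => p (z - c *: u)).
Proof.
rewrite (_ : (fun _ => _) = (fun u : 'rV[R]_n => p (z + (- c) *: u))).
  exact: continuous_affine.
by apply/funext => u; rewrite scaleNr.
Qed.

Let cp (c : R) : continuous (fun u : 'rV[R]_n => p (z + c *: u)).
Proof. exact: continuous_affine. Qed.

Let coord_cont (i : 'I_n) : continuous (fun u : 'rV[R]_n => u ord0 i).
Proof. by move=> u; exact: coord_continuous. Qed.

Let cstc (a : R) : continuous ((fun=> a) : 'rV[R]_n -> R).
Proof. by move=> ?; exact: cst_continuous. Qed.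

(** J(phi(u) p(z + c u)) = p(z) J(phi) + O(c^2). *)
Lemma weighted_integral_expansion :
  (forall i, differentiable (fun x => 'D_(delta_mx ord0 i) p x) z) ->
  exists2 C, 0 <= C & \forall c \near 0^'+,
    `|J (fun u : 'rV[R]_n => phi u * p (z + c *: u)) - p z * J phi| <= C * c ^+ 2.
Proof.
move=> ddp.
have [C C0 HC] := bigO_at0_unit_ball (bigO_at0_even_difference p_diff ddp).
have J0 : 0 <= J phi by apply: Rintegral_ge0.
exists (C * J phi / 2); first by rewrite divr_ge0// mulr_ge0.
near=> c.
have HCc : forall u, eball 0 1 u ->
    `|p (z + c *: u) + p (z - c *: u) - 2 * p z| <= C * c ^+ 2 by near: c.
have cE : continuous (fun u : 'rV[R]_n =>
    p (z + c *: u) + p (z - c *: u) + - (2 * p z)).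
  apply: continuousD_fun => //; exact: continuousD_fun.
have := weighted_integral_le phi_cont cE phi_ge0 HCc.
have -> : J (fun u : 'rV[R]_n =>
      phi u * (p (z + c *: u) + p (z - c *: u) - 2 * p z)) =
    2 * (J (fun u : 'rV[R]_n => phi u * p (z + c *: u)) - p z * J phi).
  transitivity (J (fun u : 'rV[R]_n =>
      (phi u * p (z + c *: u) + phi u * p (z - c *: u))
      + (- (2 * p z)) * phi u)).
    by apply: eq_Rintegral => u _; ring.
  have c1 := continuousM_fun phi_cont (@cp c).
  have c2 := continuousM_fun phi_cont (@cpN c).
  have c3 : continuous (fun u : 'rV[R]_n => - (2 * p z) * phi u).
    exact: continuousM_fun.
  rewrite Rintegral_unit_ballD//; last exact: continuousD_fun.
  rewrite Rintegral_unit_ballD// Rintegral_unit_ballZ//.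
  rewrite (weighted_integral_opp phi_cont phi_rot (@cpN c)).
  under [X in _ + X + _]eq_Rintegral do rewrite scalerN opprK.
  ring.
rewrite normrM (ger0_norm (ler0n R 2)) => H.
by lra.
Unshelve. all: by end_near. Qed.

(** J(phi(u) u_i p(z + c u)) = c J(u_k^2 phi(u)) d_i p(z) + O(c^3), where the
    index k is arbitrary. *)
Lemma weighted_moment_expansion (k i : 'I_n) :
  (forall i x, differentiable (fun x => 'D_(delta_mx ord0 i) p x) x) ->
  (forall i j, differentiable (fun x => 'D_(delta_mx ord0 j)
     (fun y => 'D_(delta_mx ord0 i) p y) x) z) ->
  exists2 C, 0 <= C & \forall c \near 0^'+,
    `|J (fun u : 'rV[R]_n => phi u * (u ord0 i * p (z + c *: u))) -
      c * (J (fun u : 'rV[R]_n => u ord0 k ^+ 2 * phi u) * 'D_(delta_mx ord0 i) p z)|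
    <= C * c ^+ 3.
Proof.
move=> ddp dddp.
have [C C0 HC] := bigO_at0_unit_ball (bigO_at0_odd_difference p_diff ddp dddp).
have J0 : 0 <= J phi by apply: Rintegral_ge0.
exists (C * J phi / 2); first by rewrite divr_ge0// mulr_ge0.
near=> c.
have c0 : 0 < c by [].
pose L (u : 'rV[R]_n) := \sum_j u ord0 j * 'D_(delta_mx ord0 j) p z.
have HCc : forall u, eball 0 1 u ->
    `|p (z + c *: u) - p (z - c *: u) - 2 * L (c *: u)| <= C * c ^+ 3 by near: c.
have LZ u : L (c *: u) = c * L u.
  by rewrite /L mulr_sumr; apply: eq_bigr => j _; rewrite mxE mulrA.
have cL : continuous L.
  apply: continuous_big => [|j _]; first exact: add_continuous.
  exact: continuousM_fun.
pose E (u : 'rV[R]_n) := u ord0 i * (p (z + c *: u) +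
  ((-1) * p (z - c *: u) + (- (2 * c)) * L u)).
have cE : continuous E.
  apply: continuousM_fun => //; apply: continuousD_fun => //.
  by apply: continuousD_fun => //; exact: continuousM_fun.
have EC u : eball 0 1 u -> `|E u| <= C * c ^+ 3.
  move=> Bu; rewrite normrM -[leRHS]mul1r ler_pM//.
    rewrite (le_trans (coord_le_enorm u i))//.
    by move: Bu; rewrite /eball/= subr0 => /ltW.
  have := HCc u Bu; rewrite LZ; congr (`|_| <= _); ring.
have := weighted_integral_le phi_cont cE phi_ge0 EC.
have -> : J (fun u : 'rV[R]_n => phi u * E u) =
    2 * (J (fun u : 'rV[R]_n => phi u * (u ord0 i * p (z + c *: u))) -
      c * (J (fun u : 'rV[R]_n => u ord0 k ^+ 2 * phi u) * 'D_(delta_mx ord0 i) p z)).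
  have cip := continuousM_fun (@coord_cont i) (@cp c).
  have cipN := continuousM_fun (@coord_cont i) (@cpN c).
  have ciL := continuousM_fun (@coord_cont i) cL.
  have c1 := continuousM_fun phi_cont cip.
  have c2 := continuousM_fun phi_cont cipN.
  have c3 := continuousM_fun phi_cont ciL.
  transitivity (J (fun u : 'rV[R]_n => phi u * (u ord0 i * p (z + c *: u)) +
     ((-1) * (phi u * (u ord0 i * p (z - c *: u))) +
      (- (2 * c)) * (phi u * (u ord0 i * L u))))).
    by apply: eq_Rintegral => u _; rewrite /E; ring.
  rewrite Rintegral_unit_ballD//;
    last by apply: continuousD_fun; apply: continuousM_fun.
  rewrite Rintegral_unit_ballD//; [|exact: continuousM_fun|exact: continuousM_fun].
  rewrite !Rintegral_unit_ballZ// (weighted_integral_opp phi_cont phi_rot cipN).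
  have -> : J (fun u : 'rV[R]_n => phi u * ((- u) ord0 i * p (z - c *: - u))) =
      -1 * J (fun u : 'rV[R]_n => phi u * (u ord0 i * p (z + c *: u))).
    rewrite -Rintegral_unit_ballZ//; apply: eq_Rintegral => u _.
    by rewrite scalerN opprK mxE; ring.
  have -> : J (fun u : 'rV[R]_n => phi u * (u ord0 i * L u)) =
      J (fun u : 'rV[R]_n => u ord0 k ^+ 2 * phi u) * 'D_(delta_mx ord0 i) p z.
    transitivity (J (fun u : 'rV[R]_n => \sum_j 'D_(delta_mx ord0 j) p z *
        (phi u * (u ord0 i * u ord0 j)))).
      apply: eq_Rintegral => u _; rewrite /L !mulr_sumr.
      by apply: eq_bigr => j _; ring.
    rewrite Rintegral_unit_ball_sum => [|j]; last first.
      by apply: continuousM_fun => //; do 2 apply: continuousM_fun => //.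
    rewrite (bigD1 i)//= big1 ?addr0 => [|j ji]; rewrite Rintegral_unit_ballZ//;
      rewrite ?(weighted_second_moment phi_cont phi_rot k).
    - by rewrite eqxx mulr1n mulrC.
    - by do 2 apply: continuousM_fun => //.
    - by rewrite eq_sym (negPf ji) mulr0n mulr0.
    - by do 2 apply: continuousM_fun => //.
  ring.
rewrite normrM (ger0_norm (ler0n R 2)) => H.
by lra.
Unshelve. all: by end_near. Qed.

End small_scale_expansions.

(** * Expansion of the local mean *)

(** Elementary estimate for a quotient: N0 is a perturbation of P of order c^2
    and N1 is a perturbation of c b of order c^3. *)
Lemma quotient_expansion (R : realFieldType) (c N0 N1 P b C0 C1 : R) :
  0 < c -> 0 < P -> P / 2 <= N0 -> 0 <= C1 ->
  `|N0 - P| <= C0 * c ^+ 2 -> `|N1 - c * b| <= C1 * c ^+ 3 ->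
  `|c * (N1 / N0) - c ^+ 2 * (b / P)| <=
    (C1 + `|b| / P * C0) / (P / 2) * c ^+ 4.
Proof.
move=> c0 P0 PN C10 h0 h1.
have P2 : 0 < P / 2 by rewrite divr_gt0.
have N0_gt0 : 0 < N0 by apply: lt_le_trans PN.
(* The two error terms, over the common denominator N0. *)
rewrite (_ : _ - _ = (c * (N1 - c * b) - c ^+ 2 * (b / P) * (N0 - P)) / N0);
  last by field; rewrite !gt_eqF.
rewrite normrM normfV (gtr0_norm N0_gt0) [leRHS]mulrAC ler_pM ?invr_ge0//.
- exact: ltW.
- rewrite mulrDl (le_trans (ler_normB _ _))// lerD//.
    rewrite normrM gtr0_norm// (_ : C1 * c ^+ 4 = c * (C1 * c ^+ 3)); last by ring.
    by rewrite ler_pM2l.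
  rewrite (_ : `|b| / P * C0 * c ^+ 4 = c ^+ 2 * (`|b| / P) * (C0 * c ^+ 2));
    last by ring.
  rewrite normrM ler_pM// normrM ler_pM//.
  + by rewrite ger0_norm// exprn_ge0// ltW.
  + by rewrite normrM normfV (gtr0_norm P0).
- by rewrite lef_pV2.
Qed.

Lemma norm_rV_le (R : realType) n (x : 'rV[R]_n) (M : R) : 0 <= M ->
  (forall i, `|x ord0 i| <= M) -> `|x| <= M.
Proof.
move=> M0 xM; rewrite [leLHS]/Num.norm /= mx_normrE; apply/bigmax_leP.
by split=> // -[i j] _ /=; rewrite ord1.
Qed.

Lemma near_at_right0_scale (R : realType) (k : R) (P : set R) : 0 < k ->
  (\forall c \near 0^'+, P c) -> \forall r \near 0^'+, P (k * r).
Proof.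
move=> k0 /nbhs_normP[e /= e0 eP]; apply/nbhs_normP; exists (e / k) => /=.
  by rewrite divr_gt0.
move=> r /=; rewrite sub0r normrN => re r0.
apply: eP => /=; last by rewrite mulr_gt0.
by rewrite sub0r normrN normrM gtr0_norm// mulrC -ltr_pdivlMr.
Qed.

(** The local mean after the change of variables y = z + c u, c = sqrt 2 r:
    the common factor of numerator and denominator cancels. *)
Lemma local_mean_coord (R : realType) n (phi1 p : 'rV[R]_n -> R)
    (z : 'rV[R]_n) (r : R) (i : 'I_n) : 0 < r ->
  continuous phi1 -> continuous p ->
  let phi u := phi1 (Num.sqrt 2 *: u) in
  let c := Num.sqrt 2 * r in
  let N0 := \int[lebesgue_rV R n]_(u in eball 0 1) (phi u * p (z + c *: u)) in
  let N1 := \int[lebesgue_rV R n]_(u in eball 0 1)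
    (phi u * (u ord0 i * p (z + c *: u))) in
  N0 != 0 ->
  local_mean phi1 p z r ord0 i = z ord0 i + c * (N1 / N0).
Proof.
move=> r0 cphi1 cp phi c N0 N1 N0_neq0.
have c0 : 0 < c by rewrite mulr_gt0// sqrtr_gt0.
have cphi : continuous phi.
  move=> u; apply: (@continuous_comp _ _ _
    (fun u : 'rV[R]_n => Num.sqrt 2 *: u) phi1); last exact: cphi1.
  exact: scaler_continuous.
have cresc : continuous (fun y : 'rV[R]_n => rescale phi1 r (y - z)).
  apply: continuousM_fun; first by move=> ?; exact: cst_continuous.
  move=> y; apply: (@continuous_comp _ _ _
    (fun y : 'rV[R]_n => r^-1 *: (y - z)) phi1); last exact: cphi1.
  apply: (@continuous_comp _ _ _
    (fun y : 'rV[R]_n => y - z) (fun y : 'rV[R]_n => r^-1 *: y)).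
    by apply: continuousB; [exact: cvg_id|exact: cst_continuous].
  exact: scaler_continuous.
have cw : continuous (fun y : 'rV[R]_n => rescale phi1 r (y - z) * p y).
  exact: continuousM_fun.
have ccoord : continuous (fun y : 'rV[R]_n => y ord0 i).
  by move=> u; exact: coord_continuous.
have cpz : continuous (fun u : 'rV[R]_n => p (z + c *: u)) by exact: continuous_affine.
pose K := c ^+ n * r ^- n.
have K0 : K != 0 by rewrite mulf_neq0// ?invr_eq0 expf_neq0// gt_eqF.
have resc u : rescale phi1 r (z + c *: u - z) = r ^- n * phi u.
  rewrite /rescale addrC addKr scalerA /phi; congr (_ * phi1 (_ *: _)).
  by rewrite /c mulrC mulfK// gt_eqF.
have den : \int[lebesgue_rV R n]_(y in eball z c)
    (rescale phi1 r (y - z) * p y) = K * N0.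
  rewrite Rintegral_eball// -mulrA; congr (_ * _).
  rewrite -Rintegral_unit_ballZ; last exact: continuousM_fun.
  by apply: eq_Rintegral => u _; rewrite resc mulrA.
have num : \int[lebesgue_rV R n]_(y in eball z c)
    (((rescale phi1 r (y - z) * p y) *: y) ord0 i) =
    K * (z ord0 i * N0 + c * N1).
  under eq_Rintegral do rewrite mxE.
  rewrite Rintegral_eball//; last exact: continuousM_fun.
  rewrite -mulrA; congr (_ * _).
  have c1 : continuous (fun u : 'rV[R]_n => phi u * p (z + c *: u)).
    exact: continuousM_fun.
  have c2 : continuous (fun u : 'rV[R]_n => phi u * (u ord0 i * p (z + c *: u))).
    by apply: continuousM_fun => //; exact: continuousM_fun.
  have cc (a : R) (f : 'rV[R]_n -> R) : continuous f ->
      continuous (fun u => a * f u).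
    by apply: continuousM_fun => ?; exact: cst_continuous.
  rewrite -!Rintegral_unit_ballZ// -Rintegral_unit_ballD; [|exact: cc|exact: cc].
  rewrite -Rintegral_unit_ballZ; last by apply: continuousD_fun; exact: cc.
  by apply: eq_Rintegral => u _; rewrite resc !mxE; ring.
rewrite /local_mean mxE /vector_integral mxE -/c den num.
by field; rewrite N0_neq0 K0.
Qed.

Theorem theorem3p1 (R : realType) (n : nat) (phi1 : 'rV[R]_n.+1 -> R)
  (phi1_ge0 : forall u, 0 <= phi1 u)
  (phi1_smooth : smooth phi1)
  (phi1_rot : rotation_invariant phi1)
  (phi1_neq0 : exists u, phi1 u != 0)
  (phi1_supp : forall u, ~ eball 0 (Num.sqrt 2) u -> phi1 u = 0)
  (p : 'rV[R]_n.+1 -> R)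
  (p_smooth : smooth p)
  (p_density : probability_density p)
  (z : 'rV[R]_n.+1)
  (pz_gt0 : 0 < p z) :
  (fun r : R => local_mean phi1 p z r) =
    (fun r : R => z +
       (r ^+ 2 * ((2 * constB phi1) / (constA phi1 * p z))) *: gradient p z)
    +O_ (0^'+) (fun r : R => r ^+ 4).
Proof.
pose phi (u : 'rV[R]_n.+1) := phi1 (Num.sqrt 2 *: u).
have sqrt2_gt0 : 0 < Num.sqrt 2 :> R by rewrite sqrtr_gt0.
have cphi1 : continuous phi1 by exact: (phi1_smooth 0%N).
have cp : continuous p by exact: (p_smooth 0%N).
have cphi : continuous phi.
  move=> u; apply: (@continuous_comp _ _ _
    (fun u : 'rV[R]_n.+1 => Num.sqrt 2 *: u) phi1); last exact: cphi1.
  exact: scaler_continuous.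
have phi_rot : rotation_invariant phi.
  by move=> Q oQ u; rewrite /phi scalemxAl phi1_rot.
have phi_ge0 u : 0 <= phi u by exact: phi1_ge0.
have [dp dp2] := p_smooth 3.
have ddp i x : differentiable (fun x => 'D_(delta_mx ord0 i) p x) x.
  by case: (dp2 i) => + _; apply.
have dddp i j : differentiable (fun x => 'D_(delta_mx ord0 j)
    (fun y => 'D_(delta_mx ord0 i) p y) x) z.
  by case: (dp2 i) => _ /(_ j)[+ _]; apply.
have A_gt0 : 0 < constA phi1.
  apply: (weighted_integral_gt0 cphi phi_ge0).
  have [u pu] := phi1_neq0; exists ((Num.sqrt 2)^-1 *: u).
    have [|/phi1_supp pu0] := pselect (eball 0 (Num.sqrt 2) u).
      rewrite /eball/= !subr0 enormZ gtr0_norm ?invr_gt0// mulrC.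
      by rewrite ltr_pdivrMr// mul1r.
    by rewrite pu0 eqxx in pu.
  by rewrite /phi scalerA mulfV ?gt_eqF// scale1r lt0r pu phi1_ge0.
have P_gt0 : 0 < p z * constA phi1 by rewrite mulr_gt0.
have [C0 C0_ge0 H0] := weighted_integral_expansion cphi phi_rot phi_ge0 dp
  (fun i => ddp i z).
have /choice[C1 /all_and2[C1_ge0 H1]] : forall i, exists C, 0 <= C /\
  \forall c \near 0^'+,
    `|\int[lebesgue_rV R n.+1]_(u in eball 0 1)
        (phi u * (u ord0 i * p (z + c *: u))) -
      c * (constB phi1 * 'D_(delta_mx ord0 i) p z)| <= C * c ^+ 3.
  move=> i; have [C C_ge0 H] :=
    weighted_moment_expansion cphi phi_rot phi_ge0 dp ord0 i ddp dddp.
  by exists C.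
have {}H1 : \forall c \near 0^'+, forall i,
    `|\int[lebesgue_rV R n.+1]_(u in eball 0 1)
        (phi u * (u ord0 i * p (z + c *: u))) -
      c * (constB phi1 * 'D_(delta_mx ord0 i) p z)| <= C1 i * c ^+ 3.
  exact: filter_forall.
have {}H0 := near_at_right0_scale sqrt2_gt0 H0.
have {}H1 := near_at_right0_scale sqrt2_gt0 H1.
pose P := p z * constA phi1.
(* The bound of quotient_expansion for the i-th coordinate is M i * c ^+ 4, and
   c ^+ 4 = 4 * r ^+ 4. *)
pose M i := (C1 i + `|constB phi1 * 'D_(delta_mx ord0 i) p z| / P * C0) / (P / 2).
have M_ge0 i : 0 <= M i.
  apply: divr_ge0; last by rewrite divr_ge0// ltW.
  by rewrite addr_ge0// mulr_ge0// divr_ge0// ltW.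
apply/eqaddOP/bigO_exP; exists (\sum_i M i * 4 + 1).
  by rewrite ltr_wpDl// sumr_ge0// => i _; rewrite mulr_ge0.
near=> r.
have r0 : 0 < r by [].
pose c := Num.sqrt 2 * r.
have c0 : 0 < c by rewrite mulr_gt0.
have c2 : c ^+ 2 = 2 * r ^+ 2 by rewrite exprMn sqr_sqrtr.
have h0 : `|\int[lebesgue_rV R n.+1]_(u in eball 0 1)
    (phi u * p (z + c *: u)) - P| <= C0 * c ^+ 2.
  by rewrite /c; near: r; exact: H0.
have h1 : forall i, `|\int[lebesgue_rV R n.+1]_(u in eball 0 1)
    (phi u * (u ord0 i * p (z + c *: u))) -
      c * (constB phi1 * 'D_(delta_mx ord0 i) p z)| <= C1 i * c ^+ 3.
  by rewrite /c; near: r; exact: H1.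
(* For r <= 1, C0 * c ^+ 2 = 2 * C0 * r ^+ 2 <= 2 * C0 * r. *)
have small : C0 * c ^+ 2 <= P / 2.
  have r1 : r <= 1 by near: r; exact: nbhs_right_le.
  have rP : r < P / 2 / (2 * C0 + 1).
    near: r; apply: nbhs_right_lt.
    by rewrite !divr_gt0// ltr_wpDl// mulr_ge0.
  rewrite c2; move: rP; rewrite ltr_pdivlMr; last by rewrite ltr_wpDl// mulr_ge0.
  have : C0 * r ^+ 2 <= C0 * r by rewrite ler_wpM2l// expr2 ler_piMl// ltW.
  by lra.
have N0_ge : P / 2 <= \int[lebesgue_rV R n.+1]_(u in eball 0 1)
    (phi u * p (z + c *: u)).
  by move: (le_trans h0 small); rewrite ler_distl => /andP[+ _]; lra.
have c4 : c ^+ 4 = 4 * r ^+ 4 by rewrite (exprM c 2 2) c2; ring.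
have r4 : 0 <= r ^+ 4 by rewrite exprn_ge0// ltW.
have Mi_le i : M i * 4 <= \sum_i M i * 4 + 1.
  rewrite (bigD1 i)//= -addrA lerDl addr_ge0// sumr_ge0// => j _.
  by rewrite mulr_ge0.
apply: norm_rV_le => [|i].
  by rewrite mulr_ge0// addr_ge0// sumr_ge0// => i _; rewrite mulr_ge0.
have P2_gt0 : 0 < P / 2 by rewrite divr_gt0.
apply: (@le_trans _ _ (M i * 4 * r ^+ 4)); last first.
  by rewrite (ger0_norm r4) ler_wpM2r.
rewrite -[M i * 4 * _]mulrA -c4.
have := quotient_expansion c0 P_gt0 N0_ge (C1_ge0 i) h0 (h1 i).
congr (`|_| <= _).
rewrite [RHS]mxE [X in _ = _ + X]mxE local_mean_coord//; last first.
  by rewrite gt_eqF// (lt_le_trans P2_gt0).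
rewrite -/c -/phi !mxE opprD addrACA subrr add0r; congr (_ - _).
rewrite c2 /P; field.
by rewrite !gt_eqF.
Unshelve. all: by end_near. Qed.
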